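(* Let $t$ be a positive integer. Then there exists a positive integer $\kappa(t)$ such that if a graph $G$ satisfies the following conditions: (i) $d(x)>\kappa(t)$ holds for all $x\in V(G)$; (ii) $\bar d(G_x)\le \frac{d(x)-\kappa(t)}{t}$ holds for all $x\in V(G)$; (iii) $\lambda_{\min}(G)\ge -t-1$; then $G$ is the intersection graph of some linear $(t+1)$-uniform hypergraph.
   Context: All graphs are finite, undirected and simple. $d(x)$ is the degree of $x$ in $G$, $G_x$ is the subgraph of $G$ induced on the set of neighbors of $x$, $\bar d(G_x)$ is the average degree of the graph $G_x$, and $\lambda_{\min}(G)$ is the smallest eigenvalue of the adjacency matrix of $G$. A hypergraph $H$ is a pair $(X,E)$ with $X$ a finite set (vertices) and $E$ a set of non-empty subsets of $X$ (edges). It is $h$-uniform ($h\ge 2$) if every edge has cardinality $h$; it is linear if every pair of distinct vertices is contained in at most one edge. The intersection graph of $H=(X,E)$ is the graph with vertex set $E$ in which two distinct edges $e,e'\in E$ are adjacent iff $e\cap e'\ne\emptyset$. Graphs are identified up to isomorphism. *)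

(* Defs.v *)
From HB Require Import structures.
From mathcomp Require Import all_boot all_order all_algebra.
From mathcomp Require Import classical_sets reals.
From mathcomp Require Import polyrcf.

Set Implicit Arguments.
Unset Strict Implicit.
Unset Printing Implicit Defensive.

Import Order.TTheory GRing.Theory Num.Theory.
Local Open Scope ring_scope.

Record graph := Graph {
  vertex :> finType;
  adj : rel vertex;
  adj_sym : symmetric adj;
  adj_irr : irreflexive adj
}.

Definition neighbors (G : graph) (x : G) : {set G} := [set y | adj x y]%SET.

Definition degree (G : graph) (x : G) : nat := #|neighbors x|.

Section Induced.
Variables (G : graph) (A : {set G}).

Let V : finType := {x : G | x \in A}.

Definition induced_adj : rel V := fun u v => adj (val u) (val v).

Lemma induced_adj_sym : symmetric induced_adj.
Proof. by move=> u v; apply: adj_sym. Qed.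

Lemma induced_adj_irr : irreflexive induced_adj.
Proof. by move=> u; apply: adj_irr. Qed.

Definition induced_graph : graph := Graph induced_adj_sym induced_adj_irr.

End Induced.

Definition local_graph (G : graph) (x : G) : graph :=
  induced_graph (neighbors x).

(* Equal to 0 on the graph without vertices, by the convention 0^-1 = 0. *)
Definition avg_degree (R : realType) (G : graph) : R :=
  (\sum_(x : G) degree x)%:R / #|G|%:R.

Definition adj_mx (R : realType) (G : graph) : 'M[R]_#|G| :=
  \matrix_(i, j) (adj (enum_val i) (enum_val j))%:R.

(* A matrix has finitely many eigenvalues, so this infimum is a minimum as
   soon as there is an eigenvalue (see lambda_minP); it is 0 otherwise, which
   for an adjacency matrix only happens on the graph without vertices. *)
Definition lambda_min (R : realType) (G : graph) : R :=
  inf [set a : R | eigenvalue (adj_mx R G) a]%classic.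

Lemma lambda_minP (R : realType) (G : graph) (a : R) :
  eigenvalue (adj_mx R G) a ->
  eigenvalue (adj_mx R G) (lambda_min R G) /\ lambda_min R G <= a.
Proof.
set p := char_poly (adj_mx R G).
have p_neq0 : p != 0 by apply/monic_neq0/char_poly_monic.
have rootsE b : eigenvalue (adj_mx R G) b = (b \in rootsR p).
  by rewrite eigenvalue_root_char -(roots_on_rootsR p_neq0) in_itv.
have : sorted <%R (rootsR p) by apply: sorted_roots.
case rE : (rootsR p) => [|m s]; first by rewrite rootsE rE.
move=> /= srt eig_a.
have m_le b : eigenvalue (adj_mx R G) b -> m <= b.
  rewrite rootsE rE inE => /orP[/eqP->//|bs].
  by move: srt; rewrite (path_sortedE lt_trans) => /andP[/allP/(_ _ bs)/ltW].
have m_eig : eigenvalue (adj_mx R G) m by rewrite rootsE rE mem_head.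
suff -> : lambda_min R G = m by split=> //; apply: m_le.
apply/le_anti/andP; split; first by apply: ge_inf => //; exists m => b /m_le.
by apply: lb_le_inf => [|b /m_le //]; exists m.
Qed.

Definition isomorphic (G H : graph) : Prop :=
  exists2 f : G -> H, bijective f & forall x y, adj x y = adj (f x) (f y).

Record hypergraph := Hypergraph {
  hvertex : finType;
  hedges : {set {set hvertex}};
  hedges_neq0 : forall A, A \in hedges -> A != finset.set0
}.

Definition uniform (h : nat) (H : hypergraph) : Prop :=
  forall A, A \in hedges H -> #|A| = h.

Definition linear_hypergraph (H : hypergraph) : Prop :=
  forall x y : hvertex H, x != y ->
    (#|[set A in hedges H | (x \in A) && (y \in A)]%SET| <= 1)%N.

Section Intersection.
Variable H : hypergraph.

Let V : finType := {A : {set hvertex H} | A \in hedges H}.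

Definition intersection_adj : rel V :=
  fun A B => (A != B) && (val A :&: val B != finset.set0).

Lemma intersection_adj_sym : symmetric intersection_adj.
Proof.
by move=> A B; rewrite /intersection_adj eq_sym finset.setIC.
Qed.

Lemma intersection_adj_irr : irreflexive intersection_adj.
Proof. by move=> A; rewrite /intersection_adj eqxx. Qed.

Definition intersection_graph : graph :=
  Graph intersection_adj_sym intersection_adj_irr.

End Intersection.

(* Main.v *)
Require Import Defs.
From HB Require Import structures.
From mathcomp Require Import all_boot all_order all_algebra.
From mathcomp Require Import zify ring complex.
From mathcomp Require Import reals.

(* Put s = t + 1. The eigenvalue bound makes A + s I positive semidefinite, and
   everything is obtained by testing this form on integer vectors.
   - Neighborhoods have no coclique larger than s^2, so by Ramsey's theorem large
     vertex sets inside a neighborhood contain large cliques; and a vertex is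
     joined either to fewer than s^3 or to all but fewer than s^3 vertices of a
     clique (it is then "full" on the clique).
   - Take a maximal family F of n-cliques that are pairwise "not near", and let
     F_x be the set of cliques in F on which x is full. All but boundedly many
     neighbors of x are full on a member of F_x, and those that are full on the
     same member are adjacent up to boundedly many exceptions per vertex. So if
     |F_x| <= t, Cauchy-Schwarz gives G_x an average degree of at least
     d(x)/t - O(1), against the hypothesis.
   - The vectors u_x = n 1_x - sum_(C in F_x) 1_C have the Gram matrix
     n^2 (A_xy + s [x = y] - |F_x & F_y|) + O(n). Nonnegativity of its diagonal
     gives |F_x| <= s, hence |F_x| = s; the diagonal is then O(n), and so are all
     entries, which forces |F_x & F_y| = A_xy for x <> y.
   The hyperedges F_x thus represent G. *)

Set Implicit Arguments.
Unset Strict Implicit.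
Unset Printing Implicit Defensive.

Import Order.TTheory GRing.Theory Num.Theory.
Local Open Scope ring_scope.

(** * Rayleigh quotients of a symmetric matrix *)

Section Rayleigh.
Local Open Scope sesquilinear_scope.

(** Over the complex extension [A] is unitarily diagonalizable with real spectrum; in coordinates
    [w] for an orthonormal eigenbasis both sides are sums with the same weights |w_i|^2. *)
Lemma rayleigh_ge (R : rcfType) (n : nat) (A : 'M[R]_n) (c : R) (v : 'rV[R]_n) :
  A^T = A -> (forall a, eigenvalue A a -> c <= a) ->
  c * (v *m v^T) 0 0 <= (v *m A *m v^T) 0 0.
Proof.
move=> A_sym c_le.
pose toC : {rmorphism R -> complex R} := real_complex R.
have toC_real x : toC x \is Num.real by apply/complex_realP; exists x.
have conj_toC m k (M : 'M_(m, k)) : (map_mx toC M)^t* = map_mx toC M^T.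
  by apply/matrixP=> i j; rewrite !mxE; apply/CrealP.
set B := map_mx toC A.
have B_herm : B \is hermsymmx.
  apply: realsym_hermsym; last by apply/mxOverP=> i j; rewrite mxE.
  by rewrite qualifE /= expr0 scale1r (map_mx_id (fun=> erefl)) map_trmx A_sym.
have B_eq := orthomx_spectralP (hermitian_normalmx B_herm).
have := hermitian_spectral_diag_real B_herm.
have P_unit := spectral_unit B; have := spectral_unitarymx B.
move: B_eq P_unit.
set P := spectralmx B; set d := spectral_diag B => B_eq P_unit P_unitary d_real.
(* Row [i] of the invertible matrix [P] is an eigenvector of [B], and a real eigenvalue of [B] is
   one of [A]. *)
have d_ge i : toC c <= d 0 i.
  have /complex_realP[r dE] : d 0 i \is Num.real by have /mxOverP := d_real.
  rewrite dE lecR c_le // -(eigenvalue_map toC) -[toC r]dE.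
  apply/eigenvalueP; exists (row i P).
    rewrite -row_mul [X in P *m X]B_eq !mulmxA mulmxV // mul1mx row_mul.
    by rewrite row_diag_mx -scalemxAl -rowE.
  apply/negP=> /eqP rowP0; have /row_freeP[Q PQ] : row_free P by rewrite row_free_unit.
  have /rowP/(_ i) := congr1 (row i) PQ.
  by rewrite row_mul rowP0 mul0mx !mxE eqxx => /eqP; rewrite eq_sym oner_eq0.
set w := map_mx toC v *m P^t*.
have wE : w^t* = P *m map_mx toC v^T.
  by rewrite trmx_mul map_mxM trmxCK -conj_toC.
have vv : toC ((v *m v^T) 0 0) = \sum_i w 0 i * (w 0 i)^*.
  have -> : toC ((v *m v^T) 0 0) = (w *m w^t*) 0 0.
    rewrite wE /w -(invmx_unitary P_unitary) mulmxA mulmxKV //.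
    by rewrite -map_mxM [RHS]mxE.
  rewrite [LHS]mxE; apply: eq_bigr => i _. by rewrite [w^t* _ _]mxE [w^T _ _]mxE.
have vAv : toC ((v *m A *m v^T) 0 0) = \sum_i d 0 i * (w 0 i * (w 0 i)^*).
  have -> : toC ((v *m A *m v^T) 0 0) = (w *m diag_mx d *m w^t*) 0 0.
    have -> : toC ((v *m A *m v^T) 0 0) = (map_mx toC v *m B *m map_mx toC v^T) 0 0.
      by rewrite -!map_mxM [RHS]mxE.
    by rewrite {1}B_eq wE /w -(invmx_unitary P_unitary) !mulmxA.
  rewrite mxE; apply: eq_bigr => i _; rewrite mul_mx_diag !mxE.
  by rewrite mulrA; congr (_ * _); rewrite mulrC.
rewrite -lecR -!/(toC _) rmorphM vv vAv mulr_sumr ler_sum // => i _.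
by rewrite ler_wpM2r // mul_conjC_ge0.
Qed.

End Rayleigh.

(** * The integral quadratic form of A + (t + 1) I *)

Section Form.
Variables (G : graph) (t : nat).
Implicit Types (x y : G) (S T : {set G}) (f g h : {ffun G -> int}).

(** Including the diagonal makes a clique a set that is [joined] to itself. *)
Definition cadj x y := (x == y) || adj x y.

Lemma cadj_sym : symmetric cadj.
Proof. by move=> x y; rewrite /cadj eq_sym adj_sym. Qed.

Lemma cadjxx x : cadj x x.
Proof. by rewrite /cadj eqxx. Qed.

(* The form of [A + (t + 1) I]: [cadj] already counts the diagonal once. *)
Definition qform f g : int :=
  \sum_x \sum_y (cadj x y + t * (x == y))%N%:Z * (f x * g y).

Definition ind S : {ffun G -> int} := [ffun x => (x \in S)%:Z].

Lemma qformC f g : qform f g = qform g f.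
Proof.
rewrite /qform exchange_big; apply: eq_bigr => x _; apply: eq_bigr => y _.
by rewrite cadj_sym eq_sym [f _ * _]mulrC.
Qed.

Lemma qformDl f g h : qform (f + g) h = qform f h + qform g h.
Proof.
rewrite /qform -big_split; apply: eq_bigr => x _.
by rewrite -big_split; apply: eq_bigr => y _; rewrite !ffunE mulrDl mulrDr.
Qed.

Lemma qform0l h : qform 0 h = 0.
Proof. by apply: (addrI (qform 0 h)); rewrite -qformDl !addr0. Qed.

Lemma qformNl f h : qform (- f) h = - qform f h.
Proof. by apply: (addrI (qform f h)); rewrite -qformDl !subrr qform0l. Qed.

Lemma qformMnl f h n : qform (f *+ n) h = qform f h *+ n.
Proof. by elim: n => [|n IHn]; rewrite ?qform0l // !mulrS qformDl IHn. Qed.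

Lemma qform_suml (I : finType) (P : {set I}) (F : I -> {ffun G -> int}) h :
  qform (\sum_(i in P) F i) h = \sum_(i in P) qform (F i) h.
Proof. by apply: (big_morph (qform^~ h)) => [f g|]; [apply: qformDl | apply: qform0l]. Qed.

Lemma qformDr f g h : qform h (f + g) = qform h f + qform h g.
Proof. by rewrite !(qformC h) qformDl. Qed.

Lemma qformNr f h : qform h (- f) = - qform h f.
Proof. by rewrite !(qformC h) qformNl. Qed.

Lemma qformMnr f h n : qform h (f *+ n) = qform h f *+ n.
Proof. by rewrite !(qformC h) qformMnl. Qed.

Lemma qform_sumr (I : finType) (P : {set I}) (F : I -> {ffun G -> int}) h :
  qform h (\sum_(i in P) F i) = \sum_(i in P) qform h (F i).
Proof. by rewrite qformC qform_suml; apply: eq_bigr => i _; apply: qformC. Qed.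

Definition cnbrs x S := [set y in S | cadj x y].

(** The value of the form on two indicator vectors ([qform_ind]). *)
Definition weight S T := (\sum_(x in S) #|cnbrs x T| + t * #|S :&: T|)%N.

Lemma qform_ind S T : qform (ind S) (ind T) = (weight S T)%:Z.
Proof.
rewrite /qform /weight.
transitivity (\sum_(x in S) (#|cnbrs x T| + t * (x \in T))%N%:Z).
  rewrite [RHS]big_mkcond; apply: eq_bigr => x _; rewrite ffunE.
  case: (x \in S); last by rewrite big1 // => y _; rewrite mul0r mulr0.
  rewrite PoszD -sum1_card (rmorph_sum _ _ _ _) /=.
  have -> : (t * (x \in T))%N%:Z = \sum_y (t * ((x == y) && (y \in T)))%N%:Z.
    rewrite (bigD1 x) //= eqxx big1 ?addr0 // => y; rewrite eq_sym.
    by move=> /negPf ->; rewrite muln0.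
  rewrite [X in X + _]big_mkcond -big_split /=; apply: eq_bigr => y _.
  rewrite !ffunE /cnbrs inE mul1r.
  case: (y \in T); case: cadj; case: (x == y); rewrite ?(muln0, muln1) /=; lia.
rewrite -(rmorph_sum Posz) big_split /= -big_distrr /=.
congr ((_ + t * _)%N%:Z); rewrite -sum1_card big_mkcond [RHS]big_mkcond /=.
by apply: eq_bigr => x _; rewrite inE; case: (x \in S); case: (x \in T).
Qed.

Lemma weightC S T : weight S T = weight T S.
Proof. by apply/eqP; rewrite -eqz_nat -!qform_ind qformC. Qed.

Definition psd := forall f, 0 <= qform f f.

End Form.

Lemma psd_lambda_min (R : realType) (G : graph) (t : nat) :
  - t%:R - 1 <= lambda_min R G -> psd G t.
Proof.
move=> le_lambda f.
pose v : 'rV[R]_#|G| := \row_i (f (enum_val i))%:~R.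
have adj_mx_sym : (adj_mx R G)^T = adj_mx R G.
  by apply/matrixP=> i j; rewrite !mxE adj_sym.
have := @rayleigh_ge R _ _ (- t%:R - 1) v adj_mx_sym.
move/(_ (fun a a_eig => le_trans le_lambda (lambda_minP a_eig).2)).
rewrite -subr_ge0 -(ler0z R); congr (0 <= _).
have -> : (v *m v^T) 0 0 = \sum_(x : G) (f x)%:~R ^+ 2.
  rewrite mxE (reindex (@enum_val G predT)) /=; last exact/onW_bij/enum_val_bij.
  by apply: eq_bigr => i _; rewrite !mxE expr2.
have -> : (v *m adj_mx R G *m v^T) 0 0 =
    \sum_(x : G) \sum_(y : G) (adj x y)%:R * ((f x)%:~R * (f y)%:~R).
  rewrite mxE exchange_big (reindex (@enum_val G predT)) /=; last exact/onW_bij/enum_val_bij.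
  apply: eq_bigr => j _; rewrite !mxE big_distrl /=.
  rewrite (reindex (@enum_val G predT)) /=; last exact/onW_bij/enum_val_bij.
  by apply: eq_bigr => i _; rewrite !mxE mulrAC mulrC.
rewrite mulr_sumr -sumrB rmorph_sum; apply: eq_bigr => x _ /=.
(* On the diagonal the coefficient is t + 1; off it only adjacency remains. *)
rewrite rmorph_sum /= (bigD1 x) //= [in RHS](bigD1 x) //=.
rewrite cadjxx eqxx adj_irr addrAC; congr (_ + _).
  by rewrite mul0r add0r !rmorphM /= muln1 PoszD intrD -!pmulrn; ring.
apply: eq_bigr => y; rewrite eq_sym => /negPf yx.
by rewrite /cadj yx muln0 addn0 !rmorphM.
Qed.

(** * Cliques and cocliques under semidefiniteness *)

Lemma subset_of_card (T : finType) (A : {set T}) n :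
  (n <= #|A|)%N -> exists2 B : {set T}, B \subset A & #|B| = n.
Proof.
move=> le_nA; exists [set x in take n (enum A)].
  by apply/subsetP=> x; rewrite inE => /mem_take; rewrite mem_enum.
rewrite cardsE; have /card_uniqP-> : uniq (take n (enum A)) by rewrite take_uniq ?enum_uniq.
by rewrite size_take -cardE; case: ltngtP le_nA.
Qed.

Definition joined (G : graph) (S T : {set G}) := forall x y, x \in S -> y \in T -> cadj x y.

Definition coclique (G : graph) (S : {set G}) := {in S &, forall x y, cadj x y -> x = y}.

Section Weight.
Variables (G : graph) (t : nat).
Implicit Types (x y : G) (S T : {set G}).

Lemma joinedC S T : joined S T -> joined T S.
Proof. by move=> ST x y xT yS; rewrite cadj_sym ST. Qed.

Lemma joinedS S T S' T' : S' \subset S -> T' \subset T -> joined S T -> joined S' T'.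
Proof. by move=> /subsetP sS /subsetP sT ST x y /sS xS /sT yT; apply: ST. Qed.

Lemma cnbrs_joined x S T : joined S T -> x \in S -> cnbrs x T = T.
Proof. by move=> ST xS; apply/setP=> y; rewrite inE andb_idr // => /ST->. Qed.

Lemma weight1 x T : weight t [set x] T = (#|cnbrs x T| + t * (x \in T))%N.
Proof.
rewrite /weight big_set1; congr (_ + t * _)%N.
case: (boolP (x \in T)) => xT; first by rewrite (setIidPl _) ?sub1set // cards1.
by apply/eqP; rewrite cards_eq0 setI_eq0 disjoints1.
Qed.

Lemma weight_joined S T : joined S T -> weight t S T = (#|S| * #|T| + t * #|S :&: T|)%N.
Proof.
move=> ST; congr (_ + _)%N; rewrite -sum_nat_const.
by apply: eq_bigr => x xS; rewrite (cnbrs_joined ST).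
Qed.

Lemma weight_coclique S : coclique S -> weight t S S = (t.+1 * #|S|)%N.
Proof.
move=> S_co; rewrite /weight setIid mulSn -sum1_card; congr (_ + _)%N.
apply: eq_bigr => x xS; rewrite -(cards1 x); apply: eq_card => y.
rewrite !inE; apply/andP/eqP => [[yS /S_co]|->]; last by rewrite cadjxx.
by move/(_ xS yS).
Qed.

Hypothesis G_psd : psd G t.

(** The test vector (t + 1) 1_x - 1_S gives (t + 1)^3 - (t + 1)|S| >= 0. *)
Lemma card_coclique x S : S \subset neighbors x -> coclique S -> (#|S| <= t.+1 ^ 2)%N.
Proof.
move=> /subsetP Sx S_co.
have xS : x \notin S by apply/negP=> /Sx; rewrite inE adj_irr.
have xST : joined [set x] S by move=> _ y /set1P-> /Sx; rewrite inE /cadj orbC => ->.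
have := G_psd (ind [set x] *+ t.+1 - ind S).
rewrite !(qformDl, qformDr, qformNl, qformNr, qformMnl, qformMnr) !qform_ind (weightC _ S [set x]).
rewrite (weight_coclique S_co) !weight1 (negPf xS) inE eqxx.
rewrite (cnbrs_joined xST) ?inE // (@cnbrs_joined x [set x]) ?inE //; last first.
  by move=> _ _ /set1P-> /set1P->; apply: cadjxx.
rewrite cards1; move: #|S| => k; clear => h; nia.
Qed.

(* The test vector is [(t + 1) 1_x - 1_P + 1_Q], after shrinking [P] and [Q] to the same size. *)
Lemma half_joined_clique x P Q :
    joined P P -> joined Q Q -> joined P Q -> joined [set x] P ->
    (forall y, y \in Q -> ~~ cadj x y) ->
  (t.+1 ^ 3 <= #|P|)%N -> (#|Q| < t.+1 ^ 3)%N.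
Proof.
move=> PP QQ PQ xP xQ leP; rewrite ltnNge; apply/negP=> leQ.
have [P' sP' cP'] := subset_of_card leP; have [Q' sQ' cQ'] := subset_of_card leQ.
have xQ' y : y \in Q' -> ~~ cadj x y by move/(subsetP sQ'); apply: xQ.
have {PP}PP : joined P' P' by apply: joinedS PP.
have {QQ}QQ : joined Q' Q' by apply: joinedS QQ.
have {PQ}PQ : joined P' Q' by apply: joinedS PQ.
have {xP}xP : joined [set x] P' by apply: joinedS xP.
have PQ0 : P' :&: Q' = set0.
  apply/setP=> y; rewrite !inE; apply/negP=> /andP[yP yQ].
  by have := xQ' y yQ; rewrite xP ?inE.
have [y yQ] : exists y, y \in Q' by apply/set0Pn; rewrite -card_gt0 cQ' expn_gt0.
have xP0 : x \notin P' by apply/negP=> /PQ/(_ yQ); apply/negP/xQ'.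
have xQ0 : x \notin Q' by apply/negP=> /xQ'; rewrite cadjxx.
have := G_psd (ind [set x] *+ t.+1 - ind P' + ind Q').
rewrite !(qformDl, qformDr, qformNl, qformNr, qformMnl, qformMnr) !qform_ind.
rewrite (weightC _ P' [set x]) (weightC _ Q' [set x]) (weightC _ Q' P').
rewrite (weight_joined PP) (weight_joined PQ) (weight_joined QQ) !weight1.
rewrite (negPf xP0) (negPf xQ0) inE eqxx PQ0 !setIid cards0 cP' cQ'.
rewrite (cnbrs_joined xP) ?inE // (@cnbrs_joined x [set x]) ?inE //; last first.
  by move=> _ _ /set1P-> /set1P->; apply: cadjxx.
have -> : cnbrs x Q' = set0.
  by apply/setP=> z; rewrite !inE; apply/negP=> /andP[/xQ'/negPf->].
rewrite cards1 cP' cards0; clear.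
(* Both sets have k = (t + 1)^3 vertices, so the form is k - 2(t + 1)k + 2(k^2 + tk) - 2k^2 = -k <
   0. *)
have : (0 < t.+1 ^ 3)%N by rewrite expn_gt0.
have : (t.+1 ^ 3 = t.+1 * t.+1 * t.+1)%N by rewrite !expnS expn0; lia.
move: (t.+1 ^ 3)%N => k; nia.
Qed.

End Weight.

(** * Vertices full on a clique, and nearness of cliques *)

Lemma card_bigcup_le (I T : finType) (A : {set I}) (F : I -> {set T}) k :
  {in A, forall i, #|F i| <= k}%N -> (#|\bigcup_(i in A) F i| <= #|A| * k)%N.
Proof.
move=> F_le; rewrite -sum_nat_const; pose K (U : {set T}) c := (#|U| <= c)%N.
apply: (big_ind2 K) => [|U c V d Uc Vd|i /F_le//]; first by rewrite /K cards0.
exact: leq_trans (leq_card_setU U V) (leq_add Uc Vd).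
Qed.

Lemma norm_sum_sub_le (I : finType) (A : {set I}) (F H : I -> int) (k : int) :
    {in A, forall i, `|F i - H i| <= k} ->
  `|\sum_(i in A) F i - \sum_(i in A) H i| <= #|A|%:R * k.
Proof.
move=> FH; rewrite -sumrB (le_trans (ler_norm_sum _ _ _)) //.
by rewrite mulr_natl -sumr_const; apply: ler_sum.
Qed.

Section Cliques.
Variables (G : graph) (t : nat).
Hypothesis G_psd : psd G t.
Let m := (t.+1 ^ 3)%N.
Implicit Types (x y : G) (A C D S T : {set G}).

Let m_gt0 : (0 < m)%N. Proof. by rewrite expn_gt0. Qed.

Definition full x C := (#|[set y in C | ~~ cadj x y]| < t.+1 ^ 3)%N.

(** The threshold is the size that [half_joined_clique] demands of its set [P]. *)
Definition near D C := (t.+1 ^ 3 <= #|[set x in D | full x C]|)%N.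

Definition common_cnbrs (A C : {set G}) := [set y in C | [forall x in A, cadj x y]].

Lemma joined_common_cnbrs A C : joined A (common_cnbrs A C).
Proof. by move=> x y xA; rewrite inE => /andP[_ /forall_inP]; apply. Qed.

Lemma common_cnbrs_sub A C : common_cnbrs A C \subset C.
Proof. by apply/subsetP=> y; rewrite inE => /andP[]. Qed.

Lemma card_common_cnbrs A C : {in A, forall x, full x C} ->
  (#|C| <= #|common_cnbrs A C| + #|A| * m)%N.
Proof.
move=> A_full; pose F x := [set y in C | ~~ cadj x y].
apply: (@leq_trans #|common_cnbrs A C :|: \bigcup_(x in A) F x|).
  apply/subset_leq_card/subsetP=> y yC; rewrite !inE yC /=.
  case: (boolP [forall x in A, cadj x y]) => //=.
  rewrite negb_forall_in => /exists_inP[x xA xy].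
  by apply/bigcupP; exists x => //; rewrite inE yC.
apply: leq_trans (leq_card_setU _ _) _; rewrite leq_add2l.
by apply: card_bigcup_le => x /A_full/ltnW.
Qed.

Lemma card_cnbrs x C : (#|C| = #|cnbrs x C| + #|[set y in C | ~~ cadj x y]|)%N.
Proof.
rewrite -(cardsID [set y | cadj x y] C).
by congr (_ + _)%N; apply: eq_card => y; rewrite !inE // andbC.
Qed.

Lemma full_mem x C : joined C C -> x \in C -> full x C.
Proof.
move=> CC xC; rewrite /full (_ : [set y in C | _] = set0) ?cards0 //.
by apply/setP=> y; rewrite !inE; case: (boolP (y \in C)) => // /(CC _ _ xC)->.
Qed.

(** By [half_joined_clique], the closed neighbors of [x] in [C] and the other vertices of [C] cannot
    both number [m] or more. *)
Lemma not_full_card x C : joined C C -> ~~ full x C -> (#|cnbrs x C| < m)%N.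
Proof.
move=> CC; apply: contraR; rewrite -leqNgt => le_m.
have sP : cnbrs x C \subset C by apply/subsetP=> y; rewrite inE => /andP[].
have sQ : [set y in C | ~~ cadj x y] \subset C by apply/subsetP=> y; rewrite inE => /andP[].
apply: (half_joined_clique G_psd (x := x) (P := cnbrs x C)) => //.
- exact: (joinedS sP sP CC).
- exact: (joinedS sQ sQ CC).
- exact: (joinedS sP sQ CC).
- by move=> _ y /set1P->; rewrite inE => /andP[].
by move=> y; rewrite inE => /andP[].
Qed.

(** Take [m] vertices of [D] full on [C]. They have at least |C| - m^2 common closed neighbors in
    [C]. If [x] is not full, fewer than [m] of these are joined to [x], and the rest contradict
    [half_joined_clique]. *)
Lemma near_full x C D : joined C C -> joined D D -> near D C -> joined [set x] D ->
  (m * m + 3 * m <= #|C|)%N -> full x C.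
Proof.
move=> CC DD DC xD C_ge; case: (boolP (full x C)) => // /(not_full_card CC) xC.
have [A sA cA] := subset_of_card DC.
have A_full : {in A, forall y, full y C}.
  by move=> y /(subsetP sA); rewrite inE => /andP[].
have {}sA : A \subset D by apply: subset_trans sA _; apply/subsetP=> y; rewrite inE => /andP[].
have := card_common_cnbrs A_full; rewrite cA (card_cnbrs x (common_cnbrs A C)).
set Q := [set y in _ | _]; have sQ : Q \subset common_cnbrs A C.
  by apply/subsetP=> y; rewrite inE => /andP[].
have : (#|cnbrs x (common_cnbrs A C)| <= #|cnbrs x C|)%N.
  apply/subset_leq_card/subsetP=> y; rewrite !inE => /andP[/andP[-> _] ->//].
have : (#|Q| < m)%N; last by move: C_ge xC; rewrite -/m; lia.
apply: (half_joined_clique G_psd (x := x) (P := A)); rewrite ?cA //.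
- exact: (joinedS sA sA DD).
- by apply: joinedS CC; apply: subset_trans (common_cnbrs_sub A C).
- by apply: joinedS (@joined_common_cnbrs A C).
- exact: (joinedS _ sA xD).
by move=> y; rewrite inE => /andP[].
Qed.

(** If [Z] had [m] vertices, these and [y] would have at least [m] common closed neighbors in [C],
    against [half_joined_clique] for [y]. *)
Lemma full_non_nbrs y C Z : joined C C -> joined Z Z -> full y C ->
    {in Z, forall z, full z C} -> {in Z, forall z, ~~ cadj y z} ->
  (m * m + 3 * m <= #|C|)%N -> (#|Z| < m)%N.
Proof.
move=> CC ZZ yC ZC yZ C_ge; rewrite ltnNge; apply/negP=> /subset_of_card[A sA cA].
pose B := y |: A.
have B_full : {in B, forall z, full z C}.
  by move=> z /setU1P[->//|/(subsetP sA)/ZC].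
have := card_common_cnbrs B_full.
have : (#|B| <= m.+1)%N by rewrite cardsU1 cA; case: (_ \in _).
have sAB : A \subset B by apply: subsetUr.
have AA : joined A A by apply: joinedS ZZ.
have yA z : z \in A -> ~~ cadj y z by move/(subsetP sA)/yZ.
have BP := @joined_common_cnbrs B C; have PC := common_cnbrs_sub B C.
move: (common_cnbrs B C) BP PC => P BP PC.
have : (m <= #|P|)%N -> (#|A| < m)%N.
  apply: (half_joined_clique G_psd (x := y)) => //.
  - exact: (joinedS PC PC CC).
  - by apply/joinedC/(joinedS sAB _ BP).
  - by apply: joinedS BP => //; rewrite sub1set setU11.
rewrite cA ltnn; move: C_ge; move: #|C| #|P| #|B| (m) => c p b k; clear; nia.
Qed.

(** * Approximate Gram matrix of the vectors u_x *)

Section Family.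
Variables (n : nat) (F : {set {set G}}).
Hypothesis F_clique : {in F, forall C, joined C C}.
Hypothesis F_card : {in F, forall C, #|C| = n}.
Hypothesis F_far : {in F &, forall C D, C != D -> ~~ near C D || ~~ near D C}.

Lemma weight_full x C : C \in F ->
  `|(weight t [set x] C)%:Z - n%:R * (full x C)%:R| <= (m + t)%:R.
Proof.
move=> CF; have CC := F_clique CF; rewrite weight1.
have := card_cnbrs x C; rewrite F_card //.
case: (boolP (full x C)) => [xC|xC].
  have : (#|[set y in C | ~~ cadj x y]| < m)%N by [].
  by case: (x \in C); move: #|_| #|_|; lia.
have := not_full_card CC xC; have -> : x \in C = false.
  by apply/negP=> /(full_mem CC); apply/negP.
by move: #|_| #|_|; lia.
Qed.

(** Fewer than [m] vertices of [C] are full on [D], with at most [n] closed neighbors there; each of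
    the others has fewer than [m]. The sum 2mn also bounds |C & D|, each common vertex being its own
    closed neighbor. *)
Lemma weight_not_near C D : C \in F -> D \in F -> ~~ near C D ->
  (weight t C D <= t.+1 * (2 * m * n))%N.
Proof.
move=> CF DF; rewrite -ltnNge => CD.
have le_e : (\sum_(x in C) #|cnbrs x D| <= 2 * m * n)%N.
  have le_x x : x \in C -> (#|cnbrs x D| <= m + (if full x D then n else 0))%N.
    move=> _; case: ifP => [_|/negbT/(not_full_card (F_clique DF))/ltnW].
      rewrite (leq_trans (subset_leq_card (_ : _ \subset D))) ?F_card ?leq_addl //.
      by apply/subsetP=> y; rewrite inE => /andP[].
    by rewrite addn0.
  apply: (leq_trans (leq_sum _ le_x)).
  rewrite big_split sum_nat_const F_card // -big_mkcondr /=.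
  have -> : (\sum_(x in C | full x D) n = #|[set x in C | full x D]| * n)%N.
    by rewrite -sum_nat_const; apply: eq_bigl => x; rewrite inE.
  by move: CD; rewrite -/m; move: #|_| (m) => k l; nia.
rewrite /weight mulSn leq_add // leq_mul2l (leq_trans _ le_e) ?orbT //.
rewrite -sum1_card [leqRHS](big_setID D) /= (leq_trans _ (leq_addr _ _)) //.
apply: leq_sum => x /setIP[_ xD]; rewrite card_gt0; apply/set0Pn; exists x.
by rewrite inE xD cadjxx.
Qed.

Lemma weight_family C D : C \in F -> D \in F ->
  `|(weight t C D)%:Z - (n * n * (C == D))%:R| <= (t.+1 * (2 * m * n))%:R.
Proof.
move=> CF DF; case: eqVneq => [<-|CD].
  rewrite (weight_joined _ (F_clique CF)) setIid F_card //.
  by move: m_gt0; move: (m) => k; nia.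
rewrite muln0 subr0 ger0_norm // natz lez_nat.
have /orP[] := F_far CF DF CD; first exact: weight_not_near.
by rewrite weightC; apply: weight_not_near.
Qed.

Definition uvec x (P : {set {set G}}) := ind [set x] *+ n - \sum_(C in P) ind C.

(** The first summand collects the vertex-clique errors, the second the clique-clique errors. It
    does not depend on [n], which can thus be chosen larger. *)
Definition uerr k := (k * 2 * (m + t) + k * k * (t.+1 * (2 * m)))%N.

(** [P] and [Q] may be proper parts of the sets of cliques on which [x] and [y] are full, provided
    that fullness on the other's cliques agrees with membership. *)
Lemma qform_uvec k x y (P Q : {set {set G}}) :
    P \subset F -> Q \subset F -> (#|P| <= k)%N -> (#|Q| <= k)%N ->
    {in P, forall C, full x C && (full y C == (C \in Q))} ->
    {in Q, forall C, full y C && (full x C == (C \in P))} ->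
  `|qform t (uvec x P) (uvec y Q) -
     (n * n)%:R * ((cadj x y + t * (x == y))%:R - #|P :&: Q|%:R)| <= (n * uerr k)%:R.
Proof.
move=> PF QF Pk Qk Px Qy.
rewrite !(qformDl, qformDr, qformNl, qformNr, qformMnl, qformMnr).
rewrite !qform_suml [qform t (ind [set x]) (\sum_(C in Q) _)]qform_sumr qform_ind weight1.
set a := (_ + _)%N.
have -> : a = (cadj x y + t * (x == y))%N.
  rewrite /a inE; congr (_ + _)%N; rewrite -[RHS]/(nat_of_bool _).
  case: (boolP (cadj x y)) => xy.
    rewrite (_ : cnbrs _ _ = [set y]) ?cards1 //.
    by apply/setP=> z; rewrite !inE andb_idr // => /eqP->.
  apply/eqP; rewrite cards_eq0; apply/eqP/setP=> z; rewrite !inE.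
  by apply/negP=> /andP[/eqP-> /(negP xy)].
move: (cadj x y + _)%N => {}a.
have PQ_card (A B : {set {set G}}) :
    \sum_(C in A) n%:R * (C \in B)%:R = n%:R * #|A :&: B|%:R :> int.
  rewrite -mulr_sumr; congr (_ * _).
  rewrite -sum1_card natr_sum big_mkcond [RHS]big_mkcond /=.
  by apply: eq_bigr => C _; rewrite inE; case: (C \in A); case: (C \in B).
have xQ : `|\sum_(C in Q) qform t (ind [set x]) (ind C) - n%:R * #|Q :&: P|%:R|
    <= #|Q|%:R * (m + t)%:R.
  rewrite -PQ_card; apply: norm_sum_sub_le => C CQ; rewrite qform_ind.
  by have /andP[_ /eqP<-] := Qy C CQ; apply: weight_full; apply: subsetP CQ.
have yP : `|\sum_(C in P) qform t (ind C) (ind [set y]) - n%:R * #|P :&: Q|%:R|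
    <= #|P|%:R * (m + t)%:R.
  rewrite -PQ_card; apply: norm_sum_sub_le => C CP; rewrite qform_ind weightC.
  by have /andP[_ /eqP<-] := Px C CP; apply: weight_full; apply: subsetP CP.
have PQ :
    `|\sum_(C in P) qform t (ind C) (\sum_(D in Q) ind D) - (n * n)%:R * #|P :&: Q|%:R|
    <= #|P|%:R * (#|Q|%:R * (t.+1 * (2 * m * n))%:R).
  have -> : (n * n)%:R * #|P :&: Q|%:R =
      \sum_(C in P) \sum_(D in Q) (n * n * (C == D))%:R :> int.
    rewrite mulr_natr -sumr_const big_mkcond [RHS]big_mkcond /=; apply: eq_bigr => C _.
    rewrite inE; case: (C \in P) => //=; case: (boolP (C \in Q)) => CQ.
      rewrite (bigD1 C) //= eqxx muln1 big1 ?addr0 // => D /andP[_]; rewrite eq_sym.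
      by move/negPf->; rewrite muln0.
    rewrite big1 // => D DQ; have /negPf-> : C != D by apply: contraNneq CQ => ->.
    by rewrite muln0.
  apply: norm_sum_sub_le => C CP; rewrite qform_sumr; apply: norm_sum_sub_le => D DQ.
  by rewrite qform_ind; apply: weight_family; [apply: subsetP CP | apply: subsetP DQ].
rewrite setIC in xQ.
move: (\sum_(C in Q) _) (\sum_(C in P) _) (\sum_(C in P) _) xQ yP PQ => X Z Y.
move: #|P :&: Q| => c xQ yP PQ.
(* [Z] is close to n^2 c and [X], [Y] to n c, which leaves n^2 (a - c). *)
have -> : (a%:Z *+ n - X) *+ n - (Y *+ n - Z) - (n * n)%:R * (a%:R - c%:R) =
    (Z - (n * n)%:R * c%:R) - n%:R * (X - n%:R * c%:R) - n%:R * (Y - n%:R * c%:R) :> int.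
  by rewrite -(mulr_natr a%:Z) -(mulr_natr Y) -(mulr_natr (_ - X)) !natz !PoszM; ring.
rewrite (le_trans (ler_normB _ _)) // (le_trans (lerD (ler_normB _ _) (lexx _))) //.
rewrite !normrM !normr_nat.
apply: (@le_trans _ _ (#|P|%:R * (#|Q|%:R * (t.+1 * (2 * m * n))%:R) +
    n%:R * (#|Q|%:R * (m + t)%:R) + n%:R * (#|P|%:R * (m + t)%:R))).
  by rewrite !lerD // ler_wpM2l.
rewrite -!natrM -!natrD !natz lez_nat /uerr.
move: #|P| #|Q| Pk Qk (m + t)%N => p q Pk Qk M.
have : (p * q <= k * k)%N by rewrite leq_mul.
have -> : (p * (q * (t.+1 * (2 * m * n))) = n * (p * q * (t.+1 * (2 * m))))%N by lia.
have : (q * M <= k * M)%N by rewrite leq_mul.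
have : (p * M <= k * M)%N by rewrite leq_mul.
move=> pM qM pq.
have -> : (n * (p * q * (t.+1 * (2 * m))) + n * (q * M) + n * (p * M) =
    n * (q * M + p * M + p * q * (t.+1 * (2 * m))))%N by lia.
rewrite leq_mul2l leq_add ?orbT ?leq_mul2r ?pq ?orbT //.
by rewrite mulnAC muln2 -addnn leq_add.
Qed.

End Family.

End Cliques.

(** * Ramsey's theorem and the Cauchy-Schwarz inequality *)

Lemma ramsey (G : graph) (a b : nat) (S : {set G}) : (2 ^ (a + b) <= #|S|)%N ->
  (exists K : {set G}, [/\ K \subset S, joined K K & #|K| = a]) \/
  (exists K : {set G}, [/\ K \subset S, coclique K & #|K| = b]).
Proof.
have [k] := ubnP (a + b); elim: k a b S => // k IHk [|a] b S.
  by left; exists set0; rewrite sub0set cards0; split=> // x y; rewrite inE.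
case: b => [|b]; first by right; exists set0; rewrite sub0set cards0; split=> // x y; rewrite inE.
rewrite !(addnS, addSn) !ltnS => lt_k S_ge.
have [x xS] : exists x, x \in S.
  by apply/set0Pn; rewrite -card_gt0 (leq_trans _ S_ge) // expn_gt0.
pose S1 := cnbrs x (S :\ x); pose S2 := [set y in S :\ x | ~~ cadj x y].
have := card_cnbrs x (S :\ x); rewrite -/S1 -/S2 => S12.
have := cardsD1 x S; rewrite xS => Sx.
(* Removing [x] costs one vertex, yet two parts that both fall short of half of the power of 2 would
   lose at least two. *)
have /orP[S1_ge|S2_ge] : (2 ^ (a + b.+1) <= #|S1|)%N || (2 ^ (a.+1 + b) <= #|S2|)%N.
  move: S_ge; rewrite addnS addSn Sx S12 (expnS _ (a + b).+1); lia.
- have [||[K [sK KK cK]]|[K [sK KK cK]]] := IHk a b.+1 S1; first by lia.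
  + by [].
  + have sKS : K \subset S.
      by apply: subset_trans sK _; apply/subsetP=> y; rewrite !inE => /andP[/andP[]].
    left; exists (x |: K); split; first by rewrite subUset sub1set xS.
      have xK y : y \in K -> cadj x y by move/(subsetP sK); rewrite inE => /andP[].
      move=> y z /setU1P[->|yK] /setU1P[->|zK]; rewrite ?cadjxx ?xK //.
        by rewrite cadj_sym xK.
      exact: KK.
    rewrite cardsU1 cK; case: (boolP (x \in K)) => // /(subsetP sK).
    by rewrite !inE eqxx.
  right; exists K; split=> //; apply: subset_trans sK _.
    by apply/subsetP=> y; rewrite !inE => /andP[/andP[]].
have [||[K [sK KK cK]]|[K [sK KK cK]]] := IHk a.+1 b S2; first by lia.
- by [].
- left; exists K; split=> //; apply: subset_trans sK _.
    by apply/subsetP=> y; rewrite !inE => /andP[/andP[]].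
have sKS : K \subset S.
  by apply: subset_trans sK _; apply/subsetP=> y; rewrite !inE => /andP[/andP[]].
right; exists (x |: K); split; first by rewrite subUset sub1set xS.
  have xK y : y \in K -> ~~ cadj x y by move/(subsetP sK); rewrite inE => /andP[].
  move=> y z /setU1P[->|yK] /setU1P[->|zK] //; first by rewrite (negPf (xK _ zK)).
    by rewrite cadj_sym (negPf (xK _ yK)).
  exact: KK.
rewrite cardsU1 cK; case: (boolP (x \in K)) => // /(subsetP sK).
by rewrite !inE eqxx.
Qed.

(** Sum 2 f_i f_j <= f_i^2 + f_j^2 over all pairs. *)
Lemma sqr_sum_le (I : finType) (A : {set I}) (f : I -> nat) :
  ((\sum_(i in A) f i) ^ 2 <= #|A| * \sum_(i in A) f i ^ 2)%N.
Proof.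
rewrite -(leq_pmul2l (isT : 0 < 2)%N) mulnCA [X in (_ <= _ * X)%N]mul2n -addnn mulnDr.
rewrite -mulnn big_distrlr /= big_distrr /= -[X in (_ <= _ + X)%N]sum_nat_const.
rewrite big_distrr /= -big_split /=; apply: leq_sum => i _.
rewrite -sum_nat_const -big_split big_distrr /=; apply: leq_sum => j _.
by rewrite nat_Cauchy.
Qed.

(** * Sizes and intersections of the sets F_x *)

Section Family.
Variables (G : graph) (t n : nat) (F : {set {set G}}).
Implicit Types (x y : G) (C D S : {set G}).
Hypothesis G_psd : psd G t.
Let m := (t.+1 ^ 3)%N.
Hypothesis F_clique : {in F, forall C, joined C C}.
Hypothesis F_card : {in F, forall C, #|C| = n}.
Hypothesis F_far : {in F &, forall C D, C != D -> ~~ near t C D || ~~ near t D C}.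
Hypothesis n_gt_err : (2 * uerr t t.+2 < n)%N.
Hypothesis n_ge : (m * m + 3 * m <= n)%N.

Definition fat x := [set C in F | full t x C].

Let fat_sub x : fat x \subset F. Proof. by apply/subsetP=> C; rewrite inE => /andP[]. Qed.

(** With t + 2 cliques the main term of the diagonal entry is -n^2, which the error cannot
    compensate. *)
Lemma card_fat_le x : (#|fat x| <= t.+1)%N.
Proof.
rewrite leqNgt; apply/negP=> /subset_of_card[P sP cP].
have PF := subset_trans sP (fat_sub x).
have xP : {in P, forall C, full t x C && (full t x C == (C \in P))}.
  by move=> C CP; have := subsetP sP C CP; rewrite inE CP => /andP[_ ->].
have := qform_uvec G_psd F_clique F_card F_far PF PF (eq_leq cP) (eq_leq cP) xP xP.
rewrite cadjxx eqxx muln1 setIid cP => /ler_normlP[_]; have := G_psd (uvec n x P).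
move: (qform _ _ _) (uerr _ _) n_gt_err => q e; clear => h1 h2; rewrite !natz; nia.
Qed.

(** The main terms of the diagonal entries vanish, so positivity at u_x + u_y and u_x - u_y bounds
    the mixed entry by n e, where e is [uerr t t.+2]. Its main term is then at most 2 n e < n^2,
    hence 0. *)
Lemma card_fat_inter x y : x != y -> #|fat x| = t.+1 -> #|fat y| = t.+1 ->
  #|fat x :&: fat y| = adj x y.
Proof.
move=> xy cx cy.
have est z w : #|fat z| = t.+1 -> #|fat w| = t.+1 ->
    `|qform t (uvec n z (fat z)) (uvec n w (fat w)) -
      (n * n)%:R * ((cadj z w + t * (z == w))%:R - #|fat z :&: fat w|%:R)| <= (n * uerr t t.+2)%:R.
  move=> cz cw.
  apply: (qform_uvec G_psd F_clique F_card F_far); rewrite ?fat_sub ?cz ?cw //.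
    by move=> C; rewrite !inE => /andP[-> ->] /=.
  by move=> C; rewrite !inE => /andP[-> ->] /=.
have := est x y cx cy; have := est x x cx cx; have := est y y cy cy.
rewrite !cadjxx !eqxx !muln1 !setIid cx cy {1}/cadj (negPf xy) muln0 addn0 /=.
have := G_psd (uvec n x (fat x) + uvec n y (fat y)).
have := G_psd (uvec n x (fat x) - uvec n y (fat y)).
move: (uvec n x _) (uvec n y _) => u v.
rewrite !(qformDl, qformDr, qformNl, qformNr) (qformC _ v u).
move: (qform _ _ _) (qform _ _ _) (qform _ _ _) (uerr _ _) n_gt_err => xx yx yy e; clear -t.
move: #|_| => c; case: (adj x y); rewrite !natz; nia.
Qed.

Hypothesis F_max : forall D, joined D D -> #|D| = n -> exists2 C, C \in F & near t D C.

(** Ramsey thresholds for an [n]-clique and, in [c], an [m]-clique; the other alternative is a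
    coclique one vertex too large for a neighborhood. *)
Let r := (2 ^ (n + (t.+1 ^ 2).+1))%N.
Let c := (2 ^ (m + (t.+1 ^ 2).+1))%N.

Lemma neighbors_ramsey x a S : S \subset neighbors x -> (2 ^ (a + (t.+1 ^ 2).+1) <= #|S|)%N ->
  exists K : {set G}, [/\ K \subset S, joined K K & #|K| = a].
Proof.
move=> sS /ramsey[//|[K [sK KK cK]]].
by have := card_coclique G_psd (subset_trans sK sS) KK; rewrite cK ltnn.
Qed.

(** Otherwise these neighbors contain an [n]-clique [D], near some [C] in [F]. By [near_full], [x]
    is full on [C], but so is some vertex of [D]. *)
Lemma card_no_fat x :
  (#|[set y in neighbors x | [forall C in fat x, ~~ full t y C]]| < r)%N.
Proof.
rewrite ltnNge; apply/negP=> le_r.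
have [|D [sD DD cD]] := neighbors_ramsey (x := x) _ le_r.
  by apply/subsetP=> y; rewrite inE => /andP[].
have [C CF DC] := F_max DD cD.
have xC : full t x C.
  apply: near_full DC _ _ => //; rewrite ?F_card //; first exact: F_clique.
  by move=> _ y /set1P-> /(subsetP sD); rewrite !inE /cadj => /andP[-> _]; rewrite orbT.
have /set0Pn[y] : [set y in D | full t y C] != set0.
  by rewrite -card_gt0 (leq_trans _ DC) // expn_gt0.
rewrite inE => /andP[/(subsetP sD)]; rewrite inE => /andP[_ /forall_inP/(_ C)].
by rewrite inE CF xC => /(_ isT)/negP.
Qed.

Lemma card_full_non_nbrs x y C : C \in F -> full t y C ->
  (#|[set z in neighbors x | full t z C && ~~ cadj y z]| < c)%N.
Proof.
move=> CF yC; rewrite ltnNge; apply/negP=> le_c.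
have [|Z [sZ ZZ cZ]] := neighbors_ramsey (x := x) _ le_c.
  by apply/subsetP=> z; rewrite inE => /andP[].
have : (#|Z| < m)%N; last by rewrite cZ ltnn.
apply: (full_non_nbrs G_psd (F_clique CF) ZZ yC); rewrite ?F_card //.
  by move=> z /(subsetP sZ); rewrite inE => /and3P[].
by move=> z /(subsetP sZ); rewrite inE => /and3P[].
Qed.

Lemma local_degree_sum x : (#|fat x| <= t)%N ->
  ((degree x - r) ^ 2 <= t * (\sum_(y in neighbors x) #|neighbors x :&: neighbors y| +
                              c * degree x))%N.
Proof.
move=> fat_le.
pose L := [set y in neighbors x | [forall C in fat x, ~~ full t y C]].
(* Each neighbor outside [L] chooses a clique; the default [set0] is never reached there. *)
pose f y := odflt set0 [pick C in fat x | full t y C].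
have fP y : y \in neighbors x :\: L -> (f y \in fat x) && full t y (f y).
  rewrite in_setD => /andP[yL yx]; rewrite /f; case: pickP => [C|no_C] //.
  case/negP: yL; rewrite inE yx; apply/forall_inP=> C CF.
  by have := no_C C; rewrite CF => /= ->.
pose P C := [set y in neighbors x :\: L | f y == C].
have cardP : (\sum_(C in fat x) #|P C| = #|neighbors x :\: L|)%N.
  rewrite -[RHS]sum1_card (partition_big f (mem (fat x))) /=; last by move=> y /fP/andP[].
  by apply: eq_bigr => C _; rewrite -sum1_card; apply: eq_bigl => y; rewrite !inE.
(* The sum of the squared class sizes counts, for every vertex, its own class. *)
have sumP : (\sum_(C in fat x) #|P C| ^ 2 = \sum_(y in neighbors x :\: L) #|P (f y)|)%N.
  rewrite [RHS](partition_big f (mem (fat x))) /=; last by move=> y /fP/andP[].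
  apply: eq_bigr => C _; rewrite -mulnn -sum_nat_const.
  by apply: eq_big => [y|y]; rewrite ?inE // => /andP[_ /eqP->].
have P_le y : y \in neighbors x :\: L -> (#|P (f y)| <= #|neighbors x :&: neighbors y| + c)%N.
  move=> yL; have /andP[fyF yC] := fP y yL.
  have fyF' := subsetP (fat_sub x) _ fyF.
  have := card_full_non_nbrs x fyF' yC.
  set Z := [set z in _ | _] => Z_lt.
  have sub : P (f y) \subset (neighbors x :&: neighbors y) :|: (y |: Z).
    apply/subsetP=> z; rewrite inE => /andP[zL /eqP fz].
    have /andP[_ zC] := fP z zL; rewrite fz in zC.
    move: zL; rewrite inE => /andP[_ zx].
    rewrite !inE in zx *; rewrite zx zC /cadj eq_sym /=.
    by case: (y == z); case: (adj y z).
  apply: leq_trans (subset_leq_card sub) _; apply: leq_trans (leq_card_setU _ _) _.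
  (* The strict bound on [Z] leaves room for [y] itself. *)
  by rewrite leq_add2l cardsU1; case: (_ \notin _); [exact: Z_lt | exact: ltnW].
have L_lt := card_no_fat x; rewrite -/L in L_lt.
have sL : L \subset neighbors x by apply/subsetP=> y; rewrite inE => /andP[].
have dL : (degree x - r <= #|neighbors x :\: L|)%N.
  by rewrite cardsD (setIidPr sL) leq_sub2l // ltnW.
rewrite -leq_sqr in dL; apply: leq_trans dL _; rewrite -cardP.
apply: leq_trans (sqr_sum_le _ _) _; rewrite sumP leq_mul //.
apply: leq_trans (leq_sum _ P_le) _; rewrite big_split /= sum_nat_const.
apply: leq_add; last by rewrite mulnC leq_mul2l subset_leq_card ?orbT ?subsetDl.
by rewrite [leqRHS](big_setID L) /= (setIidPr sL) leq_addl.
Qed.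

End Family.

(** * Existence of a maximal clique family *)

Lemma maximal_clique_family (G : graph) (t n : nat) : (t.+1 ^ 3 <= n)%N ->
  exists F : {set {set G}},
    [/\ {in F, forall C, joined C C}, {in F, forall C : {set G}, #|C| = n},
        {in F &, forall C D, C != D -> ~~ near t C D || ~~ near t D C}
      & forall D, joined D D -> #|D| = n -> exists2 C, C \in F & near t D C].
Proof.
move=> n_ge.
pose clique_n (C : {set G}) := [forall x : G in C, forall y : G in C, cadj x y] && (#|C| == n).
pose far C D : bool := (C != D :> {set G}) ==> (~~ near t C D || ~~ near t D C).
pose family (F : {set {set G}}) := [forall C : {set G} in F, clique_n C] &&
  [forall C : {set G} in F, forall D : {set G} in F, far C D].
have cliqueP C : reflect (joined C C /\ #|C| = n) (clique_n C).
  apply: (iffP andP) => [[/forall_inP CC /eqP cC]|[CC ->]]; split=> //.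
    by move=> x y /CC/forall_inP; apply.
  by apply/forall_inP=> x xC; apply/forall_inP=> y; apply: CC.
have family0 : family set0 by apply/andP; split; apply/forall_inP=> C; rewrite inE.
have [F /maxsetP[/andP[/forall_inP Fn /forall_inP Ffar] F_max] _] := maxset_exists family0.
exists F; split=> [C /Fn/cliqueP[]//|C /Fn/cliqueP[]//|C D CF DF CD|D DD cD].
  by have /forall_inP/(_ _ DF)/implyP := Ffar C CF; apply.
case: (boolP [exists C in F, near t D C]) => [/exists_inP//|].
rewrite negb_exists_in => /forall_inP no_near.
have {no_near} far_D C : C \in F -> far C D && far D C.
  by move=> /no_near CD; rewrite /far CD orbT !implybT.
(* If [D] is near no member, maximality puts [D] in [F]; having at least (t + 1)^3 vertices, it is
   near itself. *)
have /setP/(_ D) : D |: F = F.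
  apply: F_max (subsetUr _ _); apply/andP; split.
    by apply/forall_inP=> C /setU1P[->|/Fn//]; apply/cliqueP.
  apply/forall_inP=> C /setU1P[->|CF]; apply/forall_inP=> E /setU1P[->|EF].
  - by rewrite /far eqxx.
  - by case/andP: (far_D E EF).
  - by case/andP: (far_D C CF).
  by have /forall_inP/(_ _ EF) := Ffar C CF.
rewrite setU11 => /esym DF; exists D => //.
rewrite /near (_ : [set x in D | _] = D) ?cD //.
by apply/setP=> x; rewrite inE andb_idr // => /(full_mem t DD).
Qed.

(** * Local average degree and the representing hypergraph *)

Lemma avg_degree_local (R : realType) (G : graph) (x : G) :
  avg_degree R (local_graph x) =
    (\sum_(y in neighbors x) #|neighbors x :&: neighbors y|)%:R / (degree x)%:R.
Proof.
rewrite /avg_degree card_sig; congr (_%:R / _%:R).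
rewrite (big_sub _ (fun y => #|neighbors x :&: neighbors y|)).
apply: eq_bigr => u _; rewrite /degree -(card_imset _ val_inj).
apply: eq_card => y; rewrite !inE; apply/imsetP/andP => [[v]|[xy uy]].
  by rewrite inE => uv ->; split=> //; have := valP v; rewrite inE.
have yN : y \in neighbors x by rewrite inE.
by exists (Sub y yN); rewrite ?inE.
Qed.

Theorem theorem1p3 (t : nat) (t_gt0 : (0 < t)%N) :
  exists2 kappa : nat, (0 < kappa)%N &
    forall (R : realType) (G : graph),
      (forall x : G, (kappa < degree x)%N) ->
      (forall x : G,
        avg_degree R (local_graph x) <= ((degree x)%:R - kappa%:R) / t%:R) ->
      - t%:R - 1 <= lambda_min R G ->
      exists H : hypergraph,
        [/\ linear_hypergraph H, uniform t.+1 H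
          & isomorphic G (intersection_graph H)].
Proof.
pose m := (t.+1 ^ 3)%N.
pose n := (2 * uerr t t.+2 + m * m + 3 * m).+1.
pose r := (2 ^ (n + (t.+1 ^ 2).+1))%N.
pose c := (2 ^ (m + (t.+1 ^ 2).+1))%N.
(* If |F_x| <= t, then (d - r)^2 <= d^2 - kappa d + t c d = d^2 - 2 r d - d for the degree d, which
   is absurd; as d > r, the subtraction is not truncated. *)
exists (2 * r + t * c).+1 => // R G deg_gt avg_le le_lambda.
have G_psd := psd_lambda_min le_lambda.
have n_ge : (m * m + 3 * m <= n)%N by rewrite /n; lia.
have n_gt : (2 * uerr t t.+2 < n)%N by rewrite /n; lia.
have m_le : (m <= n)%N by rewrite /n; lia.
have [F [F_clique F_card F_far F_max]] := maximal_clique_family G m_le.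
have card_fat x : #|fat t F x| = t.+1.
  apply/eqP; rewrite eqn_leq (card_fat_le G_psd F_clique F_card F_far n_gt) ltnNge.
  apply/negP=> /(local_degree_sum G_psd F_clique F_card n_ge F_max).
  rewrite -/m -/r -/c.
  have := avg_le x; rewrite avg_degree_local; have := deg_gt x.
  clearbody r c; move: (\sum_(y in _) _)%N (degree x) => S d d_gt.
  have d_gt0 : (0 < d)%N by lia.
  rewrite ler_pdivrMr ?ltr0n // mulrAC ler_pdivlMr ?ltr0n // mulrBl.
  rewrite lerBrDr -!natrM -natrD ler_nat.
  have := d_gt; have := t_gt0; clear; nia.
have fat_inter x y : x != y -> #|fat t F x :&: fat t F y| = adj x y.
  by move=> xy; apply: (card_fat_inter G_psd F_clique F_card F_far n_gt).
(* Equal sets would share t + 1 >= 2 cliques, but distinct vertices share at most one. *)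
have fat_inj : injective (fat t F).
  move=> x y xy; apply/eqP/negPn/negP=> /fat_inter; rewrite xy setIid card_fat.
  by case: adj => // -[/eqP]; rewrite -leqn0 leqNgt t_gt0.
pose E := [set fat t F x | x : G].
have fatE x : fat t F x \in E by apply/imsetP; exists x.
have E0 A : A \in E -> A != finset.set0.
  by move=> /imsetP[x _ ->]; rewrite -card_gt0 card_fat.
(* The vertices are all subsets of G; those outside [F] lie in no edge. *)
exists (Hypergraph E0); split.
(* Two edges through both [C] and [D] would share two cliques, more than [adj] allows. *)
- move=> C D CD; rewrite leqNgt; apply/negP=> /card_gt1P[A [B [hA hB AB]]].
  move: hA hB AB; rewrite !inE /=.
  move=> /and3P[/imsetP[x _ ->] Cx Dx] /and3P[/imsetP[y _ ->] Cy Dy].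
  rewrite (inj_eq fat_inj) => /fat_inter/eqP; apply/negP; rewrite neq_ltn.
  apply/orP; right; apply: leq_ltn_trans (leq_b1 _) _; apply/card_gt1P.
  by exists C, D; rewrite !in_setI Cx Cy Dx Dy.
- by move=> A /imsetP[x _ ->]; apply: card_fat.
exists (fun x => Sub (fat t F x) (fatE x)) => [|x y].
  apply: inj_card_bij => [x y /(congr1 val)/fat_inj//|].
  by rewrite card_sig; apply: leq_imset_card.
rewrite /= /intersection_adj -val_eqE /= (inj_eq fat_inj).
case: (eqVneq x y) => [->|xy]; first by rewrite adj_irr.
by rewrite -card_gt0 fat_inter //=; case: adj.
Qed.
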